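(* Let $X$ be a Tychonoff space and let $bX$ be a Hausdorff compactification of $X$. Put $R=bX\setminus X$. Assume that $K\subseteq R$ is compact and has a countable neighborhood base in $bX$. Suppose that $(U_n)_{n\in\omega}$ is a decreasing neighborhood base of $K$ in $bX$ with $K=\bigcap_{n\in\omega}U_n$. Put $V_n=U_n\cap R$, and assume that $R\setminus V_n$ is $\sigma$-compact for every $n\in\omega$. Then $R$ is $\sigma$-compact. In particular, $R$ is a $D$-space.
   Context: A Hausdorff compactification $bX$ of $X$ is a compact Hausdorff space containing $X$ as a dense subspace. A neighborhood base of $K$ in $bX$ is a family of neighborhoods of $K$ such that every open set containing $K$ contains a member of the family. A space is $\sigma$-compact if it is a countable union of compact subsets. A space $X$ is a $D$-space if for every neighborhood assignment $\varphi$ (a map assigning to each $x\in X$ an open set $\varphi(x)\ni x$) there is a closed discrete set $D\subseteq X$ with $X=\bigcup_{d\in D}\varphi(d)$. *)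

(* Defs.v *)
From HB Require Import structures.
From mathcomp Require Import all_boot all_order all_algebra.
From mathcomp Require Import all_classical all_reals all_analysis.

Set Implicit Arguments.
Unset Strict Implicit.
Unset Printing Implicit Defensive.

Local Open Scope classical_set_scope.

Definition tychonoff_space (T : topologicalType) : Prop :=
  hausdorff_space T /\ completely_regular_space T.

(* [i] embeds [X] as a dense subspace of [bX]; the third clause says that [X]
   carries the topology induced by [i]. *)
Definition hausdorff_compactification (X bX : topologicalType) (i : X -> bX) :
    Prop :=
  [/\ compact [set: bX] /\ hausdorff_space bX,
      injective i,
      forall A : set X, open A <-> exists2 B : set bX, open B & i @^-1` B = A &
      dense (range i)].

Definition remainder (X bX : topologicalType) (i : X -> bX) : set bX :=
  ~` range i.

(* The members of a neighborhood base need not be open. *)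
Definition neighborhood_base (T : topologicalType) (K : set T)
    (B : set (set T)) : Prop :=
  B `<=` set_nbhs K /\
  forall O : set T, open O -> K `<=` O -> exists2 V, B V & V `<=` O.

(* Compactness of a subset does not depend on the ambient space, so this is
   sigma-compactness of [A] as a subspace. Finite unions are included because
   [set0] is compact. *)
Definition sigma_compact (T : topologicalType) (A : set T) : Prop :=
  exists2 F : nat -> set T, (forall n, compact (F n)) & A = \bigcup_n F n.

Definition neighborhood_assignment (T : topologicalType) (phi : T -> set T) :
    Prop :=
  forall x, open (phi x) /\ phi x x.

Definition closed_discrete (T : topologicalType) (D : set T) : Prop :=
  closed D /\ D `<=` isolated D.

Definition D_space (T : topologicalType) : Prop :=
  forall phi : T -> set T, neighborhood_assignment phi ->
    exists2 D : set T, closed_discrete D & [set: T] = \bigcup_(d in D) phi d.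

(* Main.v *)
Require Import Defs.
From HB Require Import structures.
From mathcomp Require Import all_boot all_order all_algebra.
From mathcomp Require Import all_classical all_reals all_analysis.

Set Implicit Arguments.
Unset Strict Implicit.
Unset Printing Implicit Defensive.

Local Open Scope classical_set_scope.

(* Since [K] is the intersection of the [U n], the remainder is the union of
   [K] and the sigma-compact sets [R `\` U n]. A sigma-compact T1 space
   [\bigcup_n F n] is a D-space: go through the [F n] in turn and choose
   finitely many points of the part of [F n] not covered so far whose assigned
   neighborhoods cover that part. Every point lies in a neighborhood assigned at
   some stage, which contains no point chosen later, so the set of all chosen
   points is locally finite. *)

Lemma sigma_compactU (T : topologicalType) (A B : set T) :
  compact A -> sigma_compact B -> sigma_compact (A `|` B).
Proof.
move=> cA [F cF ->]; exists (fun n => if n is m.+1 then F m else A).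
  by case.
apply/seteqP; split=> x.
  by move=> [Ax|[n _ Fx]]; [exists 0%N|exists n.+1].
by move=> [[|n] _ Fx]; [left|right; exists n].
Qed.

Lemma sigma_compact_bigcup (T : topologicalType) (A : nat -> set T) :
  (forall n, sigma_compact (A n)) -> sigma_compact (\bigcup_n A n).
Proof.
move=> sA.
have /choice[F HF] n : exists F : nat -> set T,
    (forall m, compact (F m)) /\ A n = \bigcup_m F m.
  by have [F cF AF] := sA n; exists F.
exists (fun k => if unpickle k is Some nm then F nm.1 nm.2 else set0).
  move=> k; case: (unpickle k) => [[n m]|]; last exact: compact0.
  exact: (HF n).1.
apply/seteqP; split=> x.
  move=> [n _]; rewrite (HF n).2 => -[m _ Fx].
  by exists (pickle (n, m)) => //; rewrite pickleK.
move=> [k _]; case: (unpickle k) => [[n m]|//] /= Fx.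
by exists n => //; rewrite (HF n).2; exists m.
Qed.

(** If no finite choice worked, the sets [rest A] for finite [A] inside [C] would generate a proper
    filter containing [C]. A cluster point [x] in [C] is then impossible, since [rest [set x]]
    belongs to the filter and misses the neighborhood [phi x]. *)
Lemma compact_finite_assignment (T : topologicalType) (phi : T -> set T)
    (C : set T) :
  neighborhood_assignment phi -> compact C ->
  exists A : set T,
    [/\ finite_set A, A `<=` C & C `<=` \bigcup_(d in A) phi d].
Proof.
move=> nphi cC; apply: contrapT => nA.
pose fin := [set A | finite_set A /\ A `<=` C].
pose rest A := C `\` \bigcup_(d in A) phi d.
have PF : ProperFilter (filter_from fin rest).
  apply: filter_from_proper; last first.
    move=> A [finA AC]; apply: contrapT => /set0P/negP; rewrite negbK => /eqP.
    by rewrite setD_eq0 => CA; apply: nA; exists A.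
  apply: filter_from_filter; first by exists set0; split.
  move=> A B [finA AC] [finB BC]; exists (A `|` B).
    by split; [rewrite finite_setU|rewrite subUset].
  by rewrite /rest bigcup_setU setDUr.
have [|x [Cx clx]] := cC _ PF; first by exists set0 => [|? []//]; split.
have [y [[_ nphiy] phiy]] : rest [set x] `&` phi x !=set0.
  apply: clx; last by have [? ?] := nphi x; exact: open_nbhs_nbhs.
  by exists [set x] => //; split=> [|_ ->]; first exact: finite_set1.
by apply: nphiy; exists x.
Qed.

Lemma locally_finite_closed_discrete (T : topologicalType) (D : set T) :
  accessible_space T ->
  (forall x : T, exists2 V, nbhs x V & finite_set (V `&` D)) ->
  closed_discrete D.
Proof.
move=> T1 lfD.
have isoD (x : T) : exists2 N, nbhs x N & N `&` D `<=` [set x].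
  have [V Vx finV] := lfD x.
  (* Delete from [V] the finitely many points of [D] other than [x]; they form a closed set in a T1
     space. *)
  exists (V `&` ~` ((V `&` D) `\ x)); last first.
    by move=> y [[Vy ny] Dy]; apply: contrapT => yx; apply: ny.
  apply: filterI => //; apply: open_nbhs_nbhs.
  split; last by move=> [_ /(_ erefl)].
  apply: closed_openC; move/accessible_finite_set_closed: T1; apply.
  exact: finite_setD.
split=> x.
  by have [N Nx ND] := isoD x; move=> /(_ N Nx)[y [Dy Ny]]; rewrite -(ND y).
move=> Dx; split; first exact/mem_set.
have [N Nx ND] := isoD x; exists N => //.
by apply/seteqP; split=> // _ ->; split=> //; exact: nbhs_singleton.
Qed.

Lemma sigma_compact_D_space (T : topologicalType) :
  accessible_space T -> sigma_compact [set: T] -> D_space T.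
Proof.
move=> T1 [F cF TF] phi nphi.
(* The choice is made for every pair of a stage and a covered set, with openness as a premise: [sel]
   is thus total and can drive the recursion below before the covered sets are known to be open. *)
have /choice[sel Hsel] (p : nat * set T) : exists A, open p.2 ->
    [/\ finite_set A, A `<=` F p.1 `\` p.2 &
        F p.1 `\` p.2 `<=` \bigcup_(d in A) phi d].
  have [oW|nW] := pselect (open p.2); last by exists set0.
  have [|A ?] := @compact_finite_assignment _ phi (F p.1 `\` p.2) nphi.
    by rewrite setDE; apply: compact_closedI => //; exact: open_closedC.
  by exists A.
(* [W n] is the part covered before stage [n], [A n] the choice at stage [n]. *)
pose W := fix W n := if n is m.+1
  then W m `|` \bigcup_(d in sel (m, W m)) phi d else set0.
pose A n := sel (n, W n).
have oW n : open (W n).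
  elim: n => [|n IH]; first exact: open0.
  by apply: openU => //; apply: bigcup_open => d _; case: (nphi d).
have HA n := Hsel (n, W n) (oW n).
have Wmono m n : (m <= n)%N -> W m `<=` W n.
  move=> /subnK <-; elim: (n - m)%N => // k IH; rewrite addSn.
  by move=> x /IH Wx; left.
have cover x : exists n d, A n d /\ phi d x.
  have : [set: T] x by [].
  rewrite TF => -[n _ Fx].
  have [Wx|nWx] := pselect (W n x); last first.
    by have [_ _ /(_ x)[//|d Ad dx]] := HA n; exists n, d.
  (* If [x] was covered before stage [n], descend to the stage that covered it; the descent ends
     because [W 0] is empty. *)
  by elim: n Wx {Fx} => //= n IH [/IH//|[d Ad dx]]; exists n, d.
exists (\bigcup_n A n); last first.
  apply/seteqP; split=> // x _; have [n [d [Ad dx]]] := cover x.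
  by exists d => //; exists n.
apply: locally_finite_closed_discrete => // x.
have [n [d [Ad dx]]] := cover x; exists (phi d).
  by apply: open_nbhs_nbhs; split=> //; case: (nphi d).
(* As [phi d] lies in [W n.+1] and choices at stage [m] avoid [W m], only the finite sets chosen at
   stages up to and including [n] can meet [phi d]. *)
apply: (@sub_finite_set _ _ (\bigcup_(m in `I_n.+1) A m)); last first.
  by apply: bigcup_finite => // m _; have [] := HA m.
move=> y [dy [m _ Am]]; exists m => //=; rewrite ltnS leqNgt; apply/negP => nm.
have [_ /(_ y Am)[_ nWy] _] := HA m.
by apply: nWy; apply: Wmono nm _ _; right; exists d.
Qed.

(** Push a filter on the subspace forward along [set_val]: its image clusters at a point of [C],
    which lifts because [C] lies in [R], and the lift is a cluster point since open sets of the
    subspace are traces. *)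
Lemma compact_set_type (T : topologicalType) (R C : set T) :
  C `<=` R -> compact C -> compact (set_val @^-1` C : set (set_type R)).
Proof.
move=> CR cC F PF FC.
have [|p [Cp clp]] := cC (set_val @ F) _; first exact: FC.
pose q : set_type R := SigSub (mem_set (CR _ Cp)).
exists q; split; first exact: Cp.
move=> A B FA [_ [[V oV <-] Vq] VB].
have FA' : (set_val @ F) (set_val @` A).
  by apply: (@filterS _ F _ A) => // x Ax; exists x.
have [_ [[x Ax <-] Vx]] := clp _ V FA' (open_nbhs_nbhs (conj oV Vq)).
by exists x; split=> //; exact: VB.
Qed.

Lemma sigma_compact_set_type (T : topologicalType) (R : set T) :
  sigma_compact R -> sigma_compact [set: set_type R].
Proof.
move=> [F cF RF]; exists (fun n => set_val @^-1` F n).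
  by move=> n; apply: compact_set_type => //; rewrite RF; exact: bigcup_sup.
apply/seteqP; split=> // x _; have := set_valP x; rewrite {1}RF => -[n _ Fx].
by exists n.
Qed.

Lemma accessible_set_type (T : topologicalType) (R : set T) :
  accessible_space T -> accessible_space (set_type R).
Proof.
move=> T1 x y xy; have /T1[V [oV xV yV]] : set_val x != set_val y.
  by apply: contra_neq xy; exact: val_inj.
exists (set_val @^-1` V); split; first by exists V.
  by rewrite inE; move: xV; rewrite inE.
by rewrite inE; move: yV; rewrite inE.
Qed.

(* [set_type R] is [R] with the subspace topology. *)
Theorem lemma3p44 (X bX : topologicalType) (i : X -> bX)
    (K : set bX) (U : nat -> set bX)
    (tychX : tychonoff_space X)
    (cptX : hausdorff_compactification i)
    (KR : K `<=` remainder i)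
    (Kcpt : compact K)
    (Kbase : exists2 B : set (set bX), countable B & neighborhood_base K B)
    (Udecr : forall m n : nat, (m <= n)%N -> U n `<=` U m)
    (Ubase : neighborhood_base K (range U))
    (UK : K = \bigcap_n U n)
    (RVsigma : forall n : nat,
      let V := U n `&` remainder i in sigma_compact (remainder i `\` V)) :
  sigma_compact (remainder i) /\ D_space (set_type (remainder i)).
Proof.
have sR : sigma_compact (remainder i).
  have -> : remainder i =
      K `|` \bigcup_n (remainder i `\` (U n `&` remainder i)).
    apply/seteqP; split=> [x Rx|x [/KR//|[n _ []//]]].
    have [Kx|nKx] := pselect (K x); [by left|right].
    move: nKx; rewrite UK => /existsNP[n] /not_implyP[_ nUx].
    by exists n => //; split=> // -[].
  exact: sigma_compactU Kcpt (sigma_compact_bigcup RVsigma).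
split=> //; apply: sigma_compact_D_space.
  by case: cptX => -[_ hbX] _ _ _; exact/accessible_set_type/hausdorff_accessible.
exact: sigma_compact_set_type.
Qed.
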